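(* Let $b,c$ be positive integers and let $\mathbb{H}_{\mathbb{Q}}(-b,-c)$ be the generalized quaternion algebra over $\mathbb{Q}$. If $(b,c)\in\{(1,1),(1,2),(1,3),(2,2),(2,3),(2,4),(2,5)\}$, then the norm map $\mathbf{n}:\mathbb{H}_{\mathbb{Q}}(-b,-c)\to\mathbb{Q}_{+}$ is surjective.
   Context: $\mathbb{H}_{\mathbb{Q}}(-b,-c)$ is the 4-dimensional associative unital $\mathbb{Q}$-algebra with basis $\{1,e_2,e_3,e_4\}$ and $e_2^2=-b$, $e_3^2=-c$, $e_2e_3=-e_3e_2=e_4$ (so $e_4^2=-bc$). For $x=x_1+x_2e_2+x_3e_3+x_4e_4$ the conjugate is $\overline{x}=x_1-x_2e_2-x_3e_3-x_4e_4$ and the norm is $\mathbf{n}(x)=x\overline{x}=x_1^2+bx_2^2+cx_3^2+bcx_4^2$. $\mathbb{Q}_+$ denotes the set of non-negative rational numbers. *)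

(* Defs.v *)
From HB Require Import structures.
From mathcomp Require Import all_boot all_order all_algebra.
From mathcomp Require Import ring.

Set Implicit Arguments.
Unset Strict Implicit.
Unset Printing Implicit Defensive.
Import Order.TTheory GRing.Theory Num.Theory.
Local Open Scope ring_scope.

(* [quat u v] is the generalized quaternion algebra H_Q(u, v): the Q-algebra
   with basis 1, e2, e3, e4 and e2^2 = u, e3^2 = v, e2 e3 = - e3 e2 = e4.
   [Quat x1 x2 x3 x4] stands for x1 + x2 e2 + x3 e3 + x4 e4. *)
Record quat (u v : rat) : Type :=
  Quat { qc1 : rat; qc2 : rat; qc3 : rat; qc4 : rat }.

Arguments Quat {u v}.

Section QuaternionAlgebra.
Variables u v : rat.
Local Notation H := (quat u v).
Implicit Types x y z : H.

Lemma quatP x y :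
  qc1 x = qc1 y -> qc2 x = qc2 y -> qc3 x = qc3 y -> qc4 x = qc4 y -> x = y.
Proof. by case: x y => ? ? ? ? [? ? ? ?] /= -> -> -> ->. Qed.

Definition quat_to_prod x := (qc1 x, qc2 x, qc3 x, qc4 x).
Definition quat_of_prod (t : rat * rat * rat * rat) : H :=
  let: (a1, a2, a3, a4) := t in Quat a1 a2 a3 a4.
Lemma quat_to_prodK : cancel quat_to_prod quat_of_prod.
Proof. by case. Qed.

HB.instance Definition _ := Choice.copy H (can_type quat_to_prodK).

Definition quat_zero : H := Quat 0 0 0 0.
Definition quat_opp x : H := Quat (- qc1 x) (- qc2 x) (- qc3 x) (- qc4 x).
Definition quat_add x y : H :=
  Quat (qc1 x + qc1 y) (qc2 x + qc2 y) (qc3 x + qc3 y) (qc4 x + qc4 y).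

Lemma quat_addA : associative quat_add.
Proof. by move=> x y z; apply: quatP; rewrite /= addrA. Qed.
Lemma quat_addC : commutative quat_add.
Proof. by move=> x y; apply: quatP; rewrite /= addrC. Qed.
Lemma quat_add0 : left_id quat_zero quat_add.
Proof. by move=> x; apply: quatP; rewrite /= add0r. Qed.
Lemma quat_addN : left_inverse quat_zero quat_opp quat_add.
Proof. by move=> x; apply: quatP; rewrite /= addNr. Qed.

HB.instance Definition _ :=
  GRing.isZmodule.Build H quat_addA quat_addC quat_add0 quat_addN.

Definition quat_one : H := Quat 1 0 0 0.

(* The bilinear extension of e2 e2 = u, e3 e3 = v, e4 e4 = - u v,
   e2 e3 = - e3 e2 = e4, e2 e4 = - e4 e2 = u e3, e4 e3 = - e3 e4 = v e2. *)
Definition quat_mul x y : H :=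
  let: Quat x1 x2 x3 x4 := x in
  let: Quat y1 y2 y3 y4 := y in
  Quat (x1 * y1 + u * x2 * y2 + v * x3 * y3 - u * v * x4 * y4)
       (x1 * y2 + x2 * y1 - v * x3 * y4 + v * x4 * y3)
       (x1 * y3 + x3 * y1 + u * x2 * y4 - u * x4 * y2)
       (x1 * y4 + x4 * y1 + x2 * y3 - x3 * y2).

Lemma quat_mulA : associative quat_mul.
Proof. by case=> ? ? ? ? [? ? ? ?] [? ? ? ?]; apply: quatP => /=; ring. Qed.
Lemma quat_mul1l : left_id quat_one quat_mul.
Proof. by case=> ? ? ? ?; apply: quatP => /=; ring. Qed.
Lemma quat_mul1r : right_id quat_one quat_mul.
Proof. by case=> ? ? ? ?; apply: quatP => /=; ring. Qed.
Lemma quat_mulDl : left_distributive quat_mul +%R.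
Proof. by case=> ? ? ? ? [? ? ? ?] [? ? ? ?]; apply: quatP => /=; ring. Qed.
Lemma quat_mulDr : right_distributive quat_mul +%R.
Proof. by case=> ? ? ? ? [? ? ? ?] [? ? ? ?]; apply: quatP => /=; ring. Qed.
Lemma quat_one_neq0 : quat_one != 0.
Proof. by apply/eqP => -[]. Qed.

HB.instance Definition _ := GRing.Zmodule_isNzRing.Build H
  quat_mulA quat_mul1l quat_mul1r quat_mulDl quat_mulDr quat_one_neq0.

Definition quat_scale (a : rat) x : H :=
  Quat (a * qc1 x) (a * qc2 x) (a * qc3 x) (a * qc4 x).

Lemma quat_scaleA a b x :
  quat_scale a (quat_scale b x) = quat_scale (a * b) x.
Proof. by apply: quatP; rewrite /= mulrA. Qed.
Lemma quat_scale1 : left_id 1 quat_scale.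
Proof. by move=> x; apply: quatP; rewrite /= mul1r. Qed.
Lemma quat_scaleDr : right_distributive quat_scale +%R.
Proof. by move=> a x y; apply: quatP; rewrite /= mulrDr. Qed.
Lemma quat_scaleDl x : {morph quat_scale^~ x : a b / a + b}.
Proof. by move=> a b; apply: quatP; rewrite /= mulrDl. Qed.

HB.instance Definition _ := GRing.Zmodule_isLmodule.Build rat H
  quat_scaleA quat_scale1 quat_scaleDr quat_scaleDl.

Lemma quat_scaleAl (a : rat) x y : a *: (x * y) = a *: x * y.
Proof. by case: x y => ? ? ? ? [? ? ? ?]; apply: quatP => /=; ring. Qed.
HB.instance Definition _ := GRing.Lmodule_isLalgebra.Build rat H quat_scaleAl.

Lemma quat_scaleAr (a : rat) x y : a *: (x * y) = x * (a *: y).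
Proof. by case: x y => ? ? ? ? [? ? ? ?]; apply: quatP => /=; ring. Qed.
HB.instance Definition _ := GRing.Lalgebra_isAlgebra.Build rat H quat_scaleAr.

Definition e2 : H := Quat 0 1 0 0.
Definition e3 : H := Quat 0 0 1 0.
Definition e4 : H := Quat 0 0 0 1.

Lemma quatE x : x = (qc1 x)%:A + qc2 x *: e2 + qc3 x *: e3 + qc4 x *: e4.
Proof. by apply: quatP => /=; ring. Qed.
Lemma e2_sqr : e2 ^+ 2 = u%:A.
Proof. by apply: quatP => /=; ring. Qed.
Lemma e3_sqr : e3 ^+ 2 = v%:A.
Proof. by apply: quatP => /=; ring. Qed.
Lemma e2_e3 : e2 * e3 = e4.
Proof. by apply: quatP => /=; ring. Qed.
Lemma e3_e2 : e3 * e2 = - e4.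
Proof. by apply: quatP => /=; ring. Qed.

Definition qconj x : H := Quat (qc1 x) (- qc2 x) (- qc3 x) (- qc4 x).

(* [x * qconj x] is a scalar (see [qnormP]); the norm is that scalar, as a
   rational number. *)
Definition qnorm x : rat := qc1 (x * qconj x).

Lemma qnormP x : x * qconj x = (qnorm x)%:A.
Proof. by case: x => ? ? ? ?; apply: quatP => /=; rewrite ?/qnorm /=; ring. Qed.
Lemma qnormE x :
  qnorm x =
  qc1 x ^+ 2 - u * qc2 x ^+ 2 - v * qc3 x ^+ 2 + u * v * qc4 x ^+ 2.
Proof. by case: x => ? ? ? ?; rewrite /qnorm /=; ring. Qed.

End QuaternionAlgebra.

(* Main.v *)
Require Import Defs.
From mathcomp Require Import all_boot all_order all_algebra.
From mathcomp Require Import ring zify.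
Import Order.TTheory GRing.Theory Num.Theory.
Local Open Scope ring_scope.

(** The norm is multiplicative, so the nonzero norms form a subgroup of the
    multiplicative group of the rationals, and it is enough to show that every
    positive integer [n] is a norm (of a quaternion with rational, possibly
    non-integral, coefficients). This goes by induction on [n]. If [n] is
    composite, it is a product of two smaller positive integers. The prime [2]
    is [1 + b] or [b].

    For an odd prime [p] not dividing [b], a pigeonhole argument in the field
    with [p] elements shows that [p] divides some [x^2 + b y^2 + c] with
    [0 <= x, y <= (p - 1) / 2]. If [b <= 2] and [c <= 5], which covers all the
    listed pairs, this value is at most [3 (p - 1)^2 / 4 + 5 < p^2]. It is the
    norm of [x + y e2 + e3], and it equals [m p] with [0 < m < p]. By induction
    [m] is a norm, and hence so is the quotient [p = (m p) / m]. Because the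
    coefficients may be rational, this division takes the place of the descent
    in the proof of Lagrange's four-square theorem. *)

Definition is_qnorm (u v q : rat) : Prop := exists x : quat u v, qnorm x = q.

Lemma qnormM (u v : rat) (x y : quat u v) : qnorm (x * y) = qnorm x * qnorm y.
Proof. by case: x y => ? ? ? ? [? ? ? ?]; rewrite !qnormE /=; ring. Qed.

Lemma qnormZ (u v a : rat) (x : quat u v) : qnorm (a *: x) = a ^+ 2 * qnorm x.
Proof. by case: x => ? ? ? ?; rewrite !qnormE /=; ring. Qed.

Lemma is_qnormM (u v q r : rat) :
  is_qnorm u v q -> is_qnorm u v r -> is_qnorm u v (q * r).
Proof. by move=> [x <-] [y <-]; exists (x * y); rewrite qnormM. Qed.

(** The norm of [x / n(x)] is [n(x) / n(x)^2]. *)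
Lemma is_qnormV (u v q : rat) : is_qnorm u v q -> is_qnorm u v q^-1.
Proof.
move=> [x <-]; exists ((qnorm x)^-1 *: x); rewrite qnormZ.
have [->|nz] := eqVneq (qnorm x) 0; first by rewrite invr0 mulr0.
by rewrite expr2 -mulrA mulVf // mulr1.
Qed.

Lemma is_qnorm_div (u v q r : rat) :
  is_qnorm u v q -> is_qnorm u v r -> is_qnorm u v (q / r).
Proof. by move=> qn rn; apply: is_qnormM => //; apply: is_qnormV. Qed.

Lemma is_qnorm_nat_value (b c x y z : nat) :
  is_qnorm (- b%:R) (- c%:R) (x ^ 2 + b * y ^ 2 + c * z ^ 2)%N%:R.
Proof.
exists (Quat x%:R y%:R z%:R 0).
by rewrite qnormE /= !natrD !natrM; ring.
Qed.

Lemma qnorm_ge0 (b c : nat) (x : quat (- b%:R) (- c%:R)) : 0 <= qnorm x.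
Proof.
rewrite qnormE mulrNN !mulNr !opprK.
by repeat first [exact: sqr_ge0 | exact: ler0n | apply: addr_ge0 | apply: mulr_ge0].
Qed.

(** If [x^2 = y^2] modulo [p] then [p] divides [y - x] or [y + x], and both
    numbers are smaller than [p]. *)
Lemma sqr_Fp_inj (p x y : nat) : prime p -> (x.*2 < p)%N -> (y.*2 < p)%N ->
  x%:R ^+ 2 = y%:R ^+ 2 :> 'F_p -> x = y.
Proof.
move=> p_pr.
wlog le_xy : x y / (x <= y)%N.
  move=> H ltx lty exy; have [/H|/ltnW/H] := leqP x y; first exact.
  by move=> Hyx; apply/esym/Hyx.
move=> ltx lty /eqP; rewrite eq_sym -subr_eq0 subr_sqr -natrB // -natrD -natrM.
rewrite -(dvdn_pcharf (pchar_Fp p_pr)) Euclid_dvdM //.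
by case/orP; rewrite /dvdn modn_small; lia.
Qed.

(** The values of [x^2] and those of [- c - b y^2] are two sets of
    [(p + 1) / 2] elements of the field with [p] elements, so they meet. *)
Lemma prime_dvd_sqrD (p b c : nat) : prime p -> odd p -> ~~ (p %| b)%N ->
  exists x y : nat,
    [/\ (x.*2 < p)%N, (y.*2 < p)%N & (p %| x ^ 2 + b * y ^ 2 + c)%N].
Proof.
move=> p_pr p_odd pb; set k := (p./2).+1.
have lt2 (i : 'I_k) : (i.*2 < p)%N by have := ltn_ord i; rewrite /k; lia.
have bn0 : b%:R != 0 :> 'F_p by rewrite -(dvdn_pcharf (pchar_Fp p_pr)).
pose f (i : 'I_k) : 'F_p := i%:R ^+ 2.
pose g (i : 'I_k) : 'F_p := - (b%:R * i%:R ^+ 2 + c%:R).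
have f_inj : injective f.
  by move=> i j /(sqr_Fp_inj _ _ _ p_pr (lt2 i) (lt2 j)) /val_inj.
have g_inj : injective g by move=> i j /oppr_inj/addIr/(mulfI bn0)/f_inj.
have [I0|] := posnP #|[predI codom f & codom g]|.
  have := max_card [predU codom f & codom g].
  have := cardUI (mem (codom f)) (mem (codom g)).
  rewrite I0 addn0 !card_codom //.
  by rewrite card_ord card_Fp // => ->; rewrite /k; lia.
case/card_gt0P => _ /andP[/codomP[i ->] /codomP[j efg]].
exists i, j; split=> //.
rewrite (dvdn_pcharf (pchar_Fp p_pr)) !natrD !natrM.
by move: efg; rewrite /f /g expr2 => ->; apply/eqP; ring.
Qed.

Section SmallParameters.

Variables b c : nat.
Hypotheses (b_gt0 : (0 < b)%N) (b_le2 : (b <= 2)%N).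
Hypotheses (c_gt0 : (0 < c)%N) (c_le5 : (c <= 5)%N).

(** This is where the bounds on [b] and [c] enter: they make the value given
    by the pigeonhole argument smaller than [p^2]. *)
Lemma prime_has_small_qnorm_multiple (p : nat) : prime p ->
  exists m : nat,
    [/\ (0 < m)%N, (m < p)%N & is_qnorm (- b%:R) (- c%:R) (m * p)%N%:R].
Proof.
move=> p_pr; have p_gt1 := prime_gt1 p_pr.
have [p2|p_odd] := even_prime p_pr.
  (* Here [2] itself is a norm: [1 + b 1^2] if [b = 1], and [b 1^2] if [b = 2]. *)
  exists 1%N; split=> //; have := is_qnorm_nat_value b c (2 - b) 1 0.
  by have -> // : ((2 - b) ^ 2 + b * 1 ^ 2 + c * 0 ^ 2 = 1 * p)%N
    by case: b b_gt0 b_le2 => [|[|[|?]]] //; rewrite p2; lia.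
have p_gt2 : (2 < p)%N by lia.
have pNb : ~~ (p %| b)%N by apply/negP => /(dvdn_leq b_gt0); lia.
have [x [y [ltx lty /dvdnP[m def_m]]]] := prime_dvd_sqrD p b c p_pr p_odd pNb.
exists m; split.
- by case: m def_m => // def_m; lia.
- rewrite -(ltn_pmul2r (ltnW p_gt1)) -def_m.
  have x2 : (4 * x ^ 2 <= (p - 1) ^ 2)%N by nia.
  have y2 : (4 * y ^ 2 <= (p - 1) ^ 2)%N by nia.
  have by2 : (b * y ^ 2 <= 2 * y ^ 2)%N by rewrite leq_mul2r b_le2 orbT.
  by nia.
- by rewrite -def_m; have := is_qnorm_nat_value b c x y 1; rewrite exp1n muln1.
Qed.

Lemma is_qnorm_posnat (n : nat) : (0 < n)%N -> is_qnorm (- b%:R) (- c%:R) n%:R.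
Proof.
elim/ltn_ind: n => n IHn n_gt0.
have [->|n_neq1] := eqVneq n 1%N.
  by have := is_qnorm_nat_value b c 1 0 0; rewrite !exp0n // !muln0.
have n_gt1 : (1 < n)%N by lia.
have [n_pr|n_npr] := boolP (prime n).
  have [m [m_gt0 lt_mn mn]] := prime_has_small_qnorm_multiple n n_pr.
  have := is_qnorm_div _ _ _ _ mn (IHn m lt_mn m_gt0).
  by rewrite natrM mulrAC divff ?mul1r // pnatr_eq0 -lt0n.
have [//|[d /andP[d_gt1 lt_dn] d_dvd]] := primePn n_npr; first by lia.
rewrite -(divnK d_dvd) natrM; apply: is_qnormM; apply: IHn => //.
- by rewrite ltn_Pdiv.
- by rewrite divn_gt0 ?(ltnW d_gt1) // ltnW.
- exact: ltnW.
Qed.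

Lemma is_qnorm_ge0 (q : rat) : 0 <= q -> is_qnorm (- b%:R) (- c%:R) q.
Proof.
rewrite le0r => /orP[/eqP->|q_gt0]; first by exists 0; rewrite qnormE /=; ring.
have num_gt0 : (0 < `|numq q|)%N by rewrite absz_gt0 numq_eq0 gt_eqF.
have den_gt0 : (0 < `|denq q|)%N by rewrite absz_gt0 denq_neq0.
have := is_qnorm_div _ _ _ _ (is_qnorm_posnat _ num_gt0)
                             (is_qnorm_posnat _ den_gt0).
rewrite !pmulrn !gez0_abs ?denq_ge0 ?numq_ge0 ?ltW //.
by rewrite divq_num_den.
Qed.

End SmallParameters.

Theorem proposition3p4 (b c : nat) (hb : (0 < b)%N) (hc : (0 < c)%N)
    (hbc : (b, c) \in [:: (1, 1); (1, 2); (1, 3); (2, 2); (2, 3); (2, 4);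
                          (2, 5)]%N) :
  (forall x : quat (- b%:R) (- c%:R), 0 <= qnorm x) /\
  (forall q : rat, 0 <= q ->
     exists x : quat (- b%:R) (- c%:R), qnorm x = q).
Proof.
have /andP[b_le2 c_le5] : (b <= 2)%N && (c <= 5)%N.
  have : all (fun t => (t.1 <= 2)%N && (t.2 <= 5)%N)
    [:: (1, 1); (1, 2); (1, 3); (2, 2); (2, 3); (2, 4); (2, 5)]%N by [].
  by move/allP/(_ _ hbc).
split; first exact: qnorm_ge0.
exact: is_qnorm_ge0.
Qed.
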